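(* Let $D$ be a domain, $Q$ its field of fractions, $M$ a torsion-free $D$-module and $M_Q$ the $Q$-module of fractions of $M$. (a) If $\{u_i\}_{i\in I}$ is a basis of $M_Q$ (as a $Q$-vector space) and $u_i=\frac{m_i}{d_i}$ with $m_i\in M$, $d_i\in D\setminus\{0\}$ for $i\in I$, then $\{m_i\}$ is also a basis of $M_Q$ and a maximal linearly independent subset of $M$. (b) A set $\{m_i\}\subset M$ is a maximal linearly independent subset of $M$ if and only if $\{m_i\}$ is a basis of the $Q$-vector space $M_Q$. (c) If $\{m_i\}$ is a maximal linearly independent subset of $M$, then $\bigoplus_i Dm_i$ is an essential submodule of $M$. (d) Assume that $M$ is a free $D$-module with a finite basis $\{e_i\}_{i\in I}$. A maximal linearly independent subset $\{u_i\}_{i\in I}$ of $M$ is a basis of $M$ if and only if the determinant of the change of basis matrix $(a_i^j)$, defined by $u_i=\sum_j a_i^je_j$ with $a_i^j\in D$, is in $D^\times$.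
   Context: A domain is a commutative (unital) ring in which $xy=0$ implies $x=0$ or $y=0$; $D^\times$ is its group of invertible elements. $M_Q=\{\frac{m}{d}: m\in M, d\in D\setminus\{0\}\}$ is the $Q$-vector space of fractions (the localization of $M$ at $D\setminus\{0\}$). As $M$ is torsion-free, the map $M\to M_Q$, $m\mapsto\frac m1$ is injective and $M$ is identified with its image in $M_Q$. Linear independence in $M$ is over $D$. A submodule $N'$ of $M$ is essential if $N\cap N'\neq0$ for every nonzero submodule $N$ of $M$. *)

(* Defs.v *)
From HB Require Import structures.
From mathcomp Require Import all_boot all_order all_fingroup all_algebra.
From mathcomp Require Import generic_quotient.
From mathcomp Require Import boolp classical_sets.
From mathcomp Require Import ring.

Set Implicit Arguments.
Unset Strict Implicit.
Unset Printing Implicit Defensive.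

Import GRing.Theory.
Local Open Scope ring_scope.
Local Open Scope quotient_scope.
Local Open Scope classical_set_scope.

Local Notation "x %:F" := (@FracField.tofrac _ x).

Definition torsion_free (D : idomainType) (M : lmodType D) : Prop :=
  forall (d : D) (m : M), d *: m = 0 -> d = 0 \/ m = 0.

(* The localization of M at D \ {0} is a quotient of pairs (m, d), d <> 0. The
   equivalence is the one valid for every D-module; for M torsion-free it
   amounts to d2 *: m1 = d1 *: m2 (lemma tf_mkfrac_eq). *)
Section ModuleOfFractions.
Variables (D : idomainType) (M : lmodType D).

Definition nonzero : Type := {d : D | d != 0}.

Definition nz1 : nonzero := exist _ 1 (oner_neq0 D).

Definition nz_mul (d e : nonzero) : nonzero :=
  exist _ (sval d * sval e) (mulf_neq0 (svalP d) (svalP e)).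

Local Notation prefrac := (M * {d : D | d != 0})%type.

Definition frac_rel (x y : prefrac) : bool :=
  `[< exists2 s : D, s != 0 & s *: (sval y.2 *: x.1) = s *: (sval x.2 *: y.1) >].

Fact frac_rel_refl : reflexive frac_rel.
Proof. by move=> x; apply/asboolP; exists 1; rewrite ?oner_eq0. Qed.

Fact frac_rel_sym : symmetric frac_rel.
Proof.
by move=> x y; apply/asboolP/asboolP => -[s s0 e]; exists s.
Qed.

Fact frac_rel_trans : transitive frac_rel.
Proof.
move=> [m2 [d2 p2]] [m1 [d1 p1]] [m3 [d3 p3]].
move=> /asboolP[/= s s0 e] /asboolP[/= t t0 f]; apply/asboolP => /=.
exists (s * t * d2); first by rewrite !mulf_neq0.
have -> : (s * t * d2) *: (d3 *: m1) = (t * d3) *: (s *: (d2 *: m1)).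
  by rewrite !scalerA; congr (_ *: _); ring.
have -> : (s * t * d2) *: (d1 *: m3) = (s * d1) *: (t *: (d2 *: m3)).
  by rewrite !scalerA; congr (_ *: _); ring.
by rewrite e -f !scalerA; congr (_ *: _); ring.
Qed.

Canonical frac_equiv := EquivRel frac_rel frac_rel_refl frac_rel_sym frac_rel_trans.

Definition modfrac := {eq_quot frac_rel}.
HB.instance Definition _ : EqQuotient _ frac_rel modfrac := EqQuotient.on modfrac.
HB.instance Definition _ := Choice.on modfrac.

Definition mkfrac (m : M) (d : nonzero) : modfrac := \pi_modfrac (m, d).

Lemma mkfrac_eq m1 d1 m2 d2 :
  mkfrac m1 d1 = mkfrac m2 d2 <->
  exists2 s : D, s != 0 & s *: (sval d2 *: m1) = s *: (sval d1 *: m2).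
Proof.
split=> [/eqP|h]; first by rewrite eqmodE => /asboolP.
by apply/eqP; rewrite eqmodE; apply/asboolP.
Qed.

Lemma tf_mkfrac_eq (tfM : torsion_free M) m1 d1 m2 d2 :
  mkfrac m1 d1 = mkfrac m2 d2 <-> sval d2 *: m1 = sval d1 *: m2.
Proof.
split=> [/mkfrac_eq[s s0 /eqP]|e]; last first.
  by apply/mkfrac_eq; exists 1; rewrite ?oner_eq0 // e.
rewrite -subr_eq0 -scalerBr => /eqP/tfM[/eqP|/eqP]; first by rewrite (negPf s0).
by rewrite subr_eq0 => /eqP.
Qed.

Lemma mkfracP (x : modfrac) : exists m d, x = mkfrac m d.
Proof.
by exists (repr x).1, (repr x).2; rewrite /mkfrac -surjective_pairing reprK.
Qed.

Definition modfrac_add (x y : modfrac) : modfrac :=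
  mkfrac (sval (repr y).2 *: (repr x).1 + sval (repr x).2 *: (repr y).1)
         (nz_mul (repr x).2 (repr y).2).

Definition modfrac_opp (x : modfrac) : modfrac :=
  mkfrac (- (repr x).1) (repr x).2.

Definition modfrac_scale (q : {fraction D}) (x : modfrac) : modfrac :=
  mkfrac (\n_(repr q) *: (repr x).1)
         (nz_mul (exist _ \d_(repr q) (denom_ratioP (repr q))) (repr x).2).

Lemma repr_mkfrac m d : exists2 s : D, s != 0 &
  s *: (sval d *: (repr (mkfrac m d)).1) = s *: (sval (repr (mkfrac m d)).2 *: m).
Proof.
by apply/mkfrac_eq; rewrite {1}/mkfrac -surjective_pairing reprK.
Qed.

Lemma modfrac_addE m1 d1 m2 d2 :
  modfrac_add (mkfrac m1 d1) (mkfrac m2 d2) =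
  mkfrac (sval d2 *: m1 + sval d1 *: m2) (nz_mul d1 d2).
Proof.
have [s s0 e] := repr_mkfrac m1 d1; have [t t0 f] := repr_mkfrac m2 d2.
rewrite /modfrac_add; set x := repr _ in e *; set y := repr _ in f *.
apply/mkfrac_eq; exists (s * t); first exact: mulf_neq0.
rewrite /= !scalerDr; congr (_ + _).
  transitivity ((t * sval d2 * sval y.2) *: (s *: (sval d1 *: x.1))).
    by rewrite !scalerA; congr (_ *: _); ring.
  by rewrite e !scalerA; congr (_ *: _); ring.
transitivity ((s * sval d1 * sval x.2) *: (t *: (sval d2 *: y.1))).
  by rewrite !scalerA; congr (_ *: _); ring.
by rewrite f !scalerA; congr (_ *: _); ring.
Qed.

Lemma modfrac_oppE m d : modfrac_opp (mkfrac m d) = mkfrac (- m) d.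
Proof.
have [s s0 e] := repr_mkfrac m d.
by apply/mkfrac_eq; exists s; rewrite //= !scalerN e.
Qed.

Lemma fraction_repr (q : {fraction D}) :
  q = (\n_(repr q))%:F / (\d_(repr q))%:F.
Proof.
have d0 : (\d_(repr q))%:F != 0 :> {fraction D}.
  by rewrite tofrac_eq0 denom_ratioP.
apply: (mulIf d0); rewrite divfK // -{1}[q]reprK.
unlock FracField.tofrac.
rewrite -[LHS]FracField.pi_mul; apply/eqmodP; rewrite /= FracField.equivfE.
rewrite /FracField.mulf !numden_Ratio ?mulf_neq0 ?oner_eq0 ?denom_ratioP //.
by rewrite !mulr1 mulrC.
Qed.

Lemma modfrac_scaleE (n : D) (e : nonzero) m d :
  modfrac_scale (n%:F / (sval e)%:F) (mkfrac m d) =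
  mkfrac (n *: m) (nz_mul e d).
Proof.
set q := _ / _; have [s s0 f] := repr_mkfrac m d.
rewrite /modfrac_scale; set x := repr _ in f *.
apply/mkfrac_eq; exists s => //=.
have h : \n_(repr q) * sval e = n * \d_(repr q).
  have e0 : (sval e)%:F != 0 :> {fraction D} by rewrite tofrac_eq0 (svalP e).
  have d0 : (\d_(repr q))%:F != 0 :> {fraction D}.
    by rewrite tofrac_eq0 denom_ratioP.
  apply/eqP; rewrite -tofrac_eq !tofracM -eqr_div //.
  by rewrite -fraction_repr.
transitivity ((\n_(repr q) * sval e) *: (s *: (sval d *: x.1))).
  by rewrite !scalerA; congr (_ *: _); ring.
by rewrite h f !scalerA; congr (_ *: _); ring.
Qed.

Fact modfrac_addA : associative modfrac_add.
Proof.
move=> x y z; have [m [d ->]] := mkfracP x; have [n [e ->]] := mkfracP y.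
have [p [f ->]] := mkfracP z; rewrite !modfrac_addE; apply/mkfrac_eq.
exists 1; rewrite ?oner_eq0 //= !scale1r !scalerDr !scalerA -addrA.
by congr (_ *: _ + (_ *: _ + _ *: _)); ring.
Qed.

Fact modfrac_addC : commutative modfrac_add.
Proof.
move=> x y; have [m [d ->]] := mkfracP x; have [n [e ->]] := mkfracP y.
rewrite !modfrac_addE addrC; apply/mkfrac_eq.
by exists 1; rewrite ?oner_eq0 //= [sval d * _]mulrC.
Qed.

Fact modfrac_add0 : left_id (mkfrac 0 nz1) modfrac_add.
Proof.
move=> x; have [m [d ->]] := mkfracP x; rewrite modfrac_addE scaler0 add0r.
by apply/mkfrac_eq; exists 1; rewrite ?oner_eq0 //= mul1r !scale1r.
Qed.

Fact modfrac_addN : left_inverse (mkfrac 0 nz1) modfrac_opp modfrac_add.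
Proof.
move=> x; have [m [d ->]] := mkfracP x; rewrite modfrac_oppE modfrac_addE.
apply/mkfrac_eq; exists 1; rewrite ?oner_eq0 //= !scaler0.
by rewrite scalerN addNr !scaler0.
Qed.

HB.instance Definition _ := GRing.isZmodule.Build modfrac
  modfrac_addA modfrac_addC modfrac_add0 modfrac_addN.

Lemma fractionP (q : {fraction D}) : exists n (e : nonzero),
  q = n%:F / (sval e)%:F.
Proof.
exists \n_(repr q), (exist _ \d_(repr q) (denom_ratioP (repr q))).
exact: fraction_repr.
Qed.

Lemma nonzero_tofrac (e : nonzero) : (sval e)%:F != 0 :> {fraction D}.
Proof. by rewrite tofrac_eq0 (svalP e). Qed.

Fact modfrac_scaleA p q x :
  modfrac_scale p (modfrac_scale q x) = modfrac_scale (p * q) x.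
Proof.
have [n [e ->]] := fractionP p; have [k [f ->]] := fractionP q.
have [m [d ->]] := mkfracP x.
rewrite mulf_div -!tofracM -[sval e * sval f]/(sval (nz_mul e f)) !modfrac_scaleE.
by apply/mkfrac_eq; exists 1; rewrite ?oner_eq0 //= !scalerA; congr (_ *: _); ring.
Qed.

Fact modfrac_scale1 : left_id 1 modfrac_scale.
Proof.
move=> x; have [m [d ->]] := mkfracP x.
have -> : 1 = 1%:F / (sval nz1)%:F :> {fraction D} by rewrite tofrac1 divr1.
rewrite modfrac_scaleE; apply/mkfrac_eq.
by exists 1; rewrite ?oner_eq0 //= mul1r !scale1r.
Qed.

Fact modfrac_scaleDr : right_distributive modfrac_scale +%R.
Proof.
move=> q x y; have [n [e ->]] := fractionP q.
have [m [d ->]] := mkfracP x; have [k [f ->]] := mkfracP y.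
rewrite -![GRing.add _ _]/(modfrac_add _ _) !(modfrac_addE, modfrac_scaleE).
apply/mkfrac_eq; exists 1; rewrite ?oner_eq0 //=.
by rewrite !scale1r !scalerDr !scalerA; congr (_ *: _ + _ *: _); ring.
Qed.

Fact modfrac_scaleDl x : {morph modfrac_scale^~ x : p q / p + q}.
Proof.
move=> p q; have [n [e ->]] := fractionP p; have [k [f ->]] := fractionP q.
have [m [d ->]] := mkfracP x.
rewrite addf_div ?nonzero_tofrac // -!tofracM -tofracD.
rewrite -[sval e * sval f]/(sval (nz_mul e f)) !modfrac_scaleE.
rewrite -[GRing.add _ _ in RHS]/(modfrac_add _ _) modfrac_addE.
apply/mkfrac_eq; exists 1; rewrite ?oner_eq0 //=.
by rewrite !scale1r !scalerDr !scalerA -!scalerDl; congr (_ *: _); ring.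
Qed.

HB.instance Definition _ := GRing.Zmodule_isLmodule.Build {fraction D} modfrac
  modfrac_scaleA modfrac_scale1 modfrac_scaleDr modfrac_scaleDl.

Definition tomodfrac (m : M) : modfrac := mkfrac m nz1.

Lemma tomodfrac_inj (tfM : torsion_free M) : injective tomodfrac.
Proof. by move=> m n /(tf_mkfrac_eq tfM); rewrite /= !scale1r. Qed.

Lemma mkfracE m d : mkfrac m d = (sval d)%:F^-1 *: tomodfrac m.
Proof.
rewrite -[_^-1]mul1r -tofrac1 -[RHS]/(modfrac_scale _ _) modfrac_scaleE.
by apply/mkfrac_eq; exists 1; rewrite ?oner_eq0 //= mulr1 !scale1r.
Qed.
End ModuleOfFractions.

Arguments modfrac {D} M.
Arguments nonzero D : clear implicits.

(* Finite subfamilies of an arbitrary family v : I -> V are enumerated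
   without repetition by injections f : 'I_n -> I. *)
Section Families.
Variables (R : nzRingType) (V : lmodType R).

Definition lin_indep (I : Type) (v : I -> V) : Prop :=
  forall (n : nat) (f : 'I_n -> I) (c : 'I_n -> R), injective f ->
    \sum_(k < n) c k *: v (f k) = 0 -> forall k, c k = 0.

Definition spanning (I : Type) (v : I -> V) : Prop :=
  forall x : V, exists (n : nat) (f : 'I_n -> I) (c : 'I_n -> R),
    x = \sum_(k < n) c k *: v (f k).

Definition is_basis (I : Type) (v : I -> V) : Prop :=
  lin_indep v /\ spanning v.

Definition lin_indep_set (S : set V) : Prop := lin_indep (fun x : S => val x).

Definition max_lin_indep_set (S : set V) : Prop :=
  lin_indep_set S /\
  forall T : set V, S `<=` T -> lin_indep_set T -> T = S.

(* A family is maximal linearly independent if it is linearly independent (in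
   particular injective) and the subset of its members is a maximal linearly
   independent subset. A subset S is recovered as the family of its own
   elements, (fun x : S => val x). *)
Definition max_lin_indep (I : Type) (v : I -> V) : Prop :=
  lin_indep v /\ max_lin_indep_set (range v).

Definition cyclic_submod (x : V) : set V := [set c *: x | c in [set: R]].

Definition submod_sum (I : Type) (N : I -> set V) : set V :=
  [set x | exists (n : nat) (f : 'I_n -> I) (y : 'I_n -> V),
    (forall k, N (f k) (y k)) /\ x = \sum_(k < n) y k].

Definition direct_submod_sum (I : Type) (N : I -> set V) : Prop :=
  forall (n : nat) (f : 'I_n -> I) (y : 'I_n -> V), injective f ->
    (forall k, N (f k) (y k)) -> \sum_(k < n) y k = 0 -> forall k, y k = 0.

Definition submodule (N : set V) : Prop := GRing.submod_closed (mem N).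

Definition essential_submod (N' : set V) : Prop :=
  submodule N' /\
  forall N : set V, submodule N -> N != [set 0] -> N `&` N' != [set 0].
End Families.

(* Rows and columns are reordered by the same enumeration of I, so that the
   determinant does not depend on the enumeration. *)
Definition fam_matrix (R : Type) (I : finType) (a : I -> I -> R) : 'M[R]_#|I| :=
  \matrix_(i, j) a (enum_val i) (enum_val j).

(* Main.v *)
Require Import Defs.
From mathcomp Require Import all_boot all_order all_fingroup all_algebra.
From mathcomp Require Import boolp classical_sets.

Set Implicit Arguments.
Unset Strict Implicit.
Unset Printing Implicit Defensive.

Import GRing.Theory.
Local Open Scope ring_scope.
Local Open Scope classical_set_scope.

(** The notion that links M to its module of fractions is almost spanning: a
    family m of M almost spans when every x in M has a nonzero multiple s x in
    the span of m.

    Over any nonzero ring, a linearly independent family is maximal if and only if it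
    almost spans (max_lin_indepP).  If no nonzero multiple of x lies in the
    span, then x can be adjoined to the family without creating a relation, and
    maximality puts x in the family, which is absurd as x = 1 x is then in the
    span.  Conversely, an equality s x = sum_k c_k m_k with s <> 0 is a
    nontrivial relation as soon as x is none of the m_k, so that no independent
    set containing the family can contain such an x.

    The two halves of the condition independent and almost spanning are exactly
    the two halves of the condition that the images m_i / 1 form a basis of the
    module of fractions: finitely many scalars of the fraction field have a
    common denominator, so a relation over the field, or an expression of x / 1
    in the m_i / 1, becomes one over D after multiplication by it
    (lin_indep_tomodfrac, spanning_tomodfrac).  This is (b).  Part (a) reduces
    to (b), because replacing u_i = m_i / d_i by d_i u_i = m_i / 1 multiplies
    the members of a basis by nonzero scalars (is_basis_scale).

    For (c), the sum of the D m_i is the span of m, and it is direct because a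
    relation between elements c_i m_i is a relation between the m_i.  If x is a
    nonzero element of a submodule N, some s x with s <> 0 lies in the span; it
    also lies in N, and it is nonzero because M is torsion-free.

    For (d), if u is a basis then e = B u for some matrix B over D, hence
    u = A B u, and comparing coordinates gives A B = 1.  If A is invertible
    then e = A^-1 u, hence u spans what e spans (basis_det). *)

(** * Spans and linear independence *)

Section Span.
Variables (R : nzRingType) (V : lmodType R).

Definition span (I : Type) (v : I -> V) : set V :=
  [set x | exists (n : nat) (f : 'I_n -> I) (c : 'I_n -> R),
    x = \sum_(k < n) c k *: v (f k)].

Lemma span_sum (I : Type) (J : finType) (v : I -> V) (f : J -> I)
    (c : J -> R) :
  span v (\sum_j c j *: v (f j)).
Proof.
exists #|J|, (f \o enum_val), (c \o enum_val).
by rewrite (reindex (@enum_val J predT)) //=; apply/onW_bij/enum_val_bij.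
Qed.

Lemma span_mem (I : Type) (v : I -> V) i : span v (v i).
Proof.
exists 1%N, (fun=> i), (fun=> 1).
by rewrite big_ord_recl big_ord0 scale1r addr0.
Qed.

Lemma span_submodule (I : Type) (v : I -> V) : submodule (span v).
Proof.
split=> [|a x y].
  have := span_sum v (of_void I) (of_void R).
  by rewrite big_pred0 ?inE; last case.
rewrite !inE => -[n [f [c ->]]] [p [g [b ->]]].
have := span_sum v
  (fun j => match j with inl k => f k | inr k => g k end)
  (fun j => match j with inl k => a * c k | inr k => b k end).
rewrite big_sumType /= scaler_sumr.
by under eq_bigr do rewrite -scalerA.
Qed.

Lemma span_bigsum (I : Type) (v : I -> V) (J : finType) (P : pred J)
    (y : J -> V) :
  (forall j, P j -> span v (y j)) -> span v (\sum_(j | P j) y j).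
Proof.
have [v0 vD] := span_submodule v.
move=> vy; apply: (big_ind (span v)) => // [|x z vx vz].
  by move: v0; rewrite inE.
have := vD 1 x z; rewrite !inE scale1r; exact.
Qed.

Lemma spanZ (I : Type) (v : I -> V) (a : R) x : span v x -> span v (a *: x).
Proof.
have [v0 vD] := span_submodule v.
by have := vD a x 0; rewrite !inE addr0 in v0 *; auto.
Qed.

Lemma span_coord (I : finType) (v : I -> V) (x : V) : span v x ->
  exists c : I -> R, x = \sum_i c i *: v i.
Proof.
move=> [n [f [c ->]]]; exists (fun i => \sum_(k | f k == i) c k).
rewrite (partition_big f predT) //=; apply: eq_bigr => i _.
by rewrite scaler_suml; apply: eq_bigr => k /eqP ->.
Qed.

(** Linear independence is defined by injective enumerations of indices.
    Grouping the terms with the same index extends it to arbitrary finite sums: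
    the total coefficient of each index vanishes. *)
Lemma lin_indep_sum (I : Type) (v : I -> V) (J : finType) (f : J -> I)
    (c : J -> R) :
  lin_indep v -> \sum_j c j *: v (f j) = 0 ->
  forall i, \sum_(j | `[< f j = i >]) c j = 0.
Proof.
move=> liv cv0 i.
(* r j is a representative of the fibre of f through j; enumerating the
   representatives gives an injective enumeration of the indices in use. *)
pose r j := odflt j [pick j' | `[< f j' = f j >]].
have fr j : f (r j) = f j.
  by rewrite /r; case: pickP => //= j' /asboolP.
have rE j j' : f j = f j' -> r j = r j'.
  by rewrite /r => ->; case: pickP => //= /(_ j')/asboolP.
have [j0 /asboolP <-|] := pickP (fun j => `[< f j = i >]); last first.
  by move=> fi; rewrite big_pred0.
pose A := [pred j | r j == j].
have rA j : r j \in A by rewrite inE; apply/eqP/rE/fr.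
suff /(_ (enum_rank_in (rA j0) (r j0))) /= : forall k : 'I_#|A|,
    \sum_(j | r j == enum_val k) c j = 0.
  rewrite enum_rankK_in // => rj0; rewrite -[RHS]rj0; apply: eq_bigl => j.
  by apply/asboolP/eqP => [/rE//|/(congr1 f)]; rewrite !fr.
apply: (liv _ (fun k : 'I_#|A| => f (enum_val k))).
  move=> k l /rE; have := enum_valP k; have := enum_valP l.
  by rewrite !inE => /eqP-> /eqP-> /enum_val_inj.
rewrite -[RHS]cv0 (partition_big r (mem A)) //=.
rewrite -(big_enum_val (fun a => (\sum_(j | r j == a) c j) *: v (f a))) /=.
apply: eq_bigr => a _; rewrite scaler_suml.
by apply: eq_bigr => j /eqP <-; rewrite fr.
Qed.

Lemma lin_indep_range (I : Type) (v : I -> V) :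
  lin_indep v -> lin_indep_set (range v).
Proof.
move=> liv n f c f_inj cf0.
have /choice[g vg] k : exists i, v i = val (f k).
  by have := valP (f k); rewrite inE => -[i _ <-]; exists i.
apply: (liv n g) => [k l gkl|].
  by apply/f_inj/val_inj; rewrite -!vg gkl.
by under eq_bigr do rewrite vg.
Qed.

(** In a relation between x and the v i, the term of x lies in the span of v,
    so its coefficient vanishes, and a relation between the v i remains.  The
    enlarged family is indexed by option I, with None as the index of x. *)
Lemma lin_indep_adjoin (I : Type) (v : I -> V) (x : V) :
    lin_indep v -> (forall s : R, span v (s *: x) -> s = 0) ->
  lin_indep (oapp v x).
Proof.
move=> liv xfree n f c f_inj cf0.
have c0 k : f k = None -> c k = 0.
  move=> fk; apply: xfree.
  have /eqP := cf0; rewrite (bigD1 k) //= fk /= addr_eq0 => /eqP ->.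
  rewrite -scaleN1r; apply: spanZ; apply: span_bigsum => l lk.
  case fl: (f l) => [i|] /=; first exact/spanZ/span_mem.
  by case/eqP: lk; apply: f_inj; rewrite fl.
move=> k; case fk: (f k) => [i|]; last exact: c0.
(* The indices None may be replaced by i, since their coefficients vanish. *)
have /(_ i) : forall i', \sum_(l | `[< odflt i (f l) = i' >]) c l = 0.
  apply: (lin_indep_sum liv); rewrite -[RHS]cf0; apply: eq_bigr => l _.
  by case fl: (f l) => //=; rewrite c0 // !scale0r.
rewrite (bigD1 k) /=; last by apply/asboolP; rewrite fk.
rewrite big1 ?addr0 //.
move=> l /andP[/asboolP fl lk]; apply: c0; case fl' : (f l) fl => [j|] //= ji.
by case/eqP: lk; apply: f_inj; rewrite fl' fk ji.
Qed.

(** Maximality among independent sets, expressed by the span alone: this form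
    is the one that can be compared with the module of fractions. *)
Lemma max_lin_indepP (I : Type) (v : I -> V) :
  max_lin_indep v <->
  lin_indep v /\ forall x, exists2 s : R, s != 0 & span v (s *: x).
Proof.
split=> -[liv].
  move=> [_ maxv]; split=> // x; apply: contrapT => nx.
  have free s : span v (s *: x) -> s = 0.
    by move=> vx; apply/eqP; apply: contrapT => /negP s0; apply: nx; exists s.
  have eqr : range (oapp v x) = range v.
    apply: maxv; last exact/lin_indep_range/lin_indep_adjoin.
    by move=> _ [i _ <-]; exists (Some i).
  have [i _ vi] : range v x by rewrite -eqr; exists None.
  by apply: nx; exists 1; rewrite ?oner_neq0 // scale1r -vi; exact: span_mem.
move=> dep; split=> //; split; first exact: lin_indep_range.
move=> T vT liT; apply/seteqP; split=> // x Tx; apply: contrapT => nvx.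
have [s /eqP s0 [n [f [c sx]]]] := dep x; apply: s0.
have Tf k : v (f k) \in T by rewrite inE; apply: vT; exists (f k).
have Tx' : x \in T by rewrite inE.
(* The relation s x - sum_k c k v (f k) = 0 between members of T, in which the
   coefficient of x is s because x is not a v (f k). *)
pose g (o : unit + 'I_n) : T :=
  match o with inl _ => exist _ x Tx' | inr k => exist _ (v (f k)) (Tf k) end.
pose b (o : unit + 'I_n) := match o with inl _ => s | inr k => - c k end.
have : \sum_o b o *: val (g o) = 0.
  rewrite big_sumType /= (big_pred1 tt) => [|[]//]; rewrite sx -big_split /=.
  by rewrite big1 // => k _; rewrite scaleNr subrr.
move=> /(lin_indep_sum liT)/(_ (g (inl tt))).
rewrite big_sumType /= (big_pred1 tt) => [|[]]; last exact/asboolP.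
rewrite big_pred0 ?addr0 // => k.
by apply/asboolP => /(congr1 val) /= vfx; apply: nvx; exists (f k).
Qed.

Lemma submod_sum_cyclic (I : Type) (v : I -> V) :
  submod_sum (fun i => cyclic_submod (v i)) = span v.
Proof.
apply/seteqP; split=> x [n [f]].
  move=> [y [vy ->]]; apply: span_bigsum => k _.
  by have [c _ <-] := vy k; exact/spanZ/span_mem.
move=> [c ->]; exists n, f, (fun k => c k *: v (f k)); split=> // k.
by exists (c k).
Qed.

Lemma direct_submod_sum_cyclic (I : Type) (v : I -> V) :
  lin_indep v -> direct_submod_sum (fun i => cyclic_submod (v i)).
Proof.
move=> liv n f y f_inj vy y0 k.
have /choice[c cy] l : exists c, c *: v (f l) = y l.
  by have [c _ cy] := vy l; exists c.
rewrite -cy (liv n f c f_inj) ?scale0r //.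
by under eq_bigr do rewrite cy.
Qed.
End Span.

(** * The module of fractions *)

Section Fractions.
Variables (D : idomainType) (M : lmodType D).
Local Notation "x %:F" := (@FracField.tofrac _ x).

Lemma tomodfracZ (a : D) (x : M) : tomodfrac (a *: x) = a%:F *: tomodfrac x.
Proof.
have -> : a%:F = a%:F / (sval (nz1 D))%:F by rewrite tofrac1 divr1.
rewrite -[RHS]/(modfrac_scale _ _) modfrac_scaleE; apply/mkfrac_eq.
by exists 1; rewrite ?oner_neq0 //= mul1r.
Qed.

Lemma tomodfracD (x y : M) : tomodfrac (x + y) = tomodfrac x + tomodfrac y.
Proof.
rewrite -[RHS]/(modfrac_add _ _) modfrac_addE; apply/mkfrac_eq.
by exists 1; rewrite ?oner_neq0 //= !scale1r mul1r scale1r.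
Qed.

Lemma tomodfrac0 : tomodfrac (0 : M) = 0.
Proof. by rewrite -(scale0r 0) tomodfracZ tofrac0 scale0r. Qed.

Lemma tomodfrac_sum (J : finType) (c : J -> D) (x : J -> M) :
  tomodfrac (\sum_j c j *: x j) = \sum_j (c j)%:F *: tomodfrac (x j).
Proof.
rewrite (big_morph _ tomodfracD tomodfrac0).
by apply: eq_bigr => j _; exact: tomodfracZ.
Qed.

Lemma common_denominator (J : finType) (q : J -> {fraction D}) :
  exists (d : nonzero D) (c : J -> D), forall j, (sval d)%:F * q j = (c j)%:F.
Proof.
have /choice[ne qE] j :
    exists ne : D * nonzero D, q j = ne.1%:F / (sval ne.2)%:F.
  by have [n [e qe]] := fractionP (q j); exists (n, e).
have d0 : \prod_j sval (ne j).2 != 0.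
  by apply/prodf_neq0 => j _; exact: (svalP (ne j).2).
exists (exist _ (\prod_j sval (ne j).2) d0).
exists (fun j => (ne j).1 * \prod_(i | i != j) sval (ne i).2) => j /=.
by rewrite (bigD1 j) //= !tofracM qE mulrC mulrA divfK // nonzero_tofrac.
Qed.

(** A relation over the fraction field becomes one over D after multiplication
    by a common denominator of its coefficients. *)
Lemma lin_indep_tomodfrac (tfM : torsion_free M) (I : Type) (m : I -> M) :
  lin_indep (fun i => tomodfrac (m i)) <-> lin_indep m.
Proof.
split=> lim n f c f_inj cm0 k.
  apply/eqP; rewrite -tofrac_eq0; apply/eqP; move: k.
  apply: (lim n f) => //; rewrite -tomodfrac_sum cm0.
  exact: tomodfrac0.
have [d [b qb]] := common_denominator c.
apply: (mulfI (nonzero_tofrac d)); rewrite mulr0 qb (lim n f) ?tofrac0 //.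
apply: (tomodfrac_inj tfM); rewrite tomodfrac_sum.
under eq_bigr do rewrite -qb -scalerA.
by rewrite -scaler_sumr cm0 scaler0 tomodfrac0.
Qed.

(** The scalar s is a common denominator of the coordinates of x / 1.
    Conversely, if s x = sum_k c_k m_k then
    x / d = sum_k (c_k / (d s)) m_k. *)
Lemma spanning_tomodfrac (tfM : torsion_free M) (I : Type) (m : I -> M) :
  spanning (fun i => tomodfrac (m i)) <->
  forall x, exists2 s : D, s != 0 & span m (s *: x).
Proof.
split=> [spm x|dep y].
  have [n [f [q xq]]] := spm (tomodfrac x).
  have [d [c qc]] := common_denominator q.
  exists (sval d); first exact: (svalP d).
  exists n, f, c; apply: (tomodfrac_inj tfM).
  rewrite tomodfracZ xq tomodfrac_sum scaler_sumr.
  by apply: eq_bigr => k _; rewrite scalerA qc.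
have [x [d ->]] := mkfracP y; have [s s0 [n [f [c sx]]]] := dep x.
have sF0 : s%:F != 0 :> {fraction D} by rewrite tofrac_eq0.
exists n, f, (fun k => ((sval d)%:F * s%:F)^-1 * (c k)%:F).
under eq_bigr do rewrite -scalerA.
rewrite -scaler_sumr -tomodfrac_sum -sx tomodfracZ mkfracE scalerA.
by rewrite invfM -mulrA mulVf // mulr1.
Qed.

Lemma max_lin_indep_tomodfrac (tfM : torsion_free M) (I : Type) (m : I -> M) :
  max_lin_indep m <-> is_basis (fun i => tomodfrac (m i)).
Proof.
rewrite max_lin_indepP /is_basis lin_indep_tomodfrac //.
by rewrite spanning_tomodfrac.
Qed.

(** A nonzero x in N has a multiple s x with s <> 0 in the span, and s x is a
    nonzero common element since M is torsion-free. *)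
Lemma essential_span (tfM : torsion_free M) (I : Type) (m : I -> M) :
  max_lin_indep m -> essential_submod (span m).
Proof.
move=> /max_lin_indepP[_ dep]; split; first exact: span_submodule.
move=> N [N0 ND] /eqP N_neq0; apply/eqP => NI.
have [x Nx x0] : exists2 x, N x & x <> 0.
  apply: contrapT => nx; apply: N_neq0; apply/seteqP; split=> x /=.
    by move=> Nx; apply: contrapT => x0; apply: nx; exists x.
  by move->; rewrite inE in N0.
have [s s0 sx] := dep x.
have : (N `&` span m) (s *: x).
  by split=> //; have := ND s x 0; rewrite !addr0 !inE in N0 *; apply.
by rewrite NI => /tfM[/eqP|//]; rewrite (negPf s0).
Qed.
End Fractions.

Lemma is_basis_scale (K : fieldType) (V : lmodType K) (I : Type)
    (v : I -> V) (q : I -> K) :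
  (forall i, q i != 0) -> is_basis v -> is_basis (fun i => q i *: v i).
Proof.
move=> q0 [liv spv]; split=> [n f c f_inj cv0 k|x].
  apply: (mulIf (q0 (f k))); rewrite mul0r; move: k; apply: (liv n f) => //.
  by rewrite -[RHS]cv0; apply: eq_bigr => k _; rewrite scalerA.
have [n [f [c ->]]] := spv x; exists n, f, (fun k => c k / q (f k)).
by apply: eq_bigr => k _; rewrite scalerA divfK.
Qed.

(** * Change of basis matrices *)

Section ChangeOfBasis.
Variables (D : comUnitRingType) (V : lmodType D) (I : finType).

Lemma fam_matrix_mul (a b : I -> I -> D) :
  fam_matrix a *m fam_matrix b = fam_matrix (fun i j => \sum_k a i k * b k j).
Proof.
apply/matrixP => i j; rewrite !mxE (reindex (@enum_val I predT)) /=; last first.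
  exact/onW_bij/enum_val_bij.
by apply: eq_bigr => k _; rewrite !mxE.
Qed.

Lemma lin_indep_coord (v : I -> V) (c b : I -> D) : lin_indep v ->
  \sum_i c i *: v i = \sum_i b i *: v i -> c =1 b.
Proof.
move=> liv /eqP; rewrite -subr_eq0 -sumrB => /eqP cb0 i.
have /(lin_indep_sum liv)/(_ i) : \sum_j (c j - b j) *: v j = 0.
  by rewrite -[RHS]cb0; apply: eq_bigr => j _; rewrite scalerBl.
rewrite (big_pred1 i) => [/eqP|j]; first by rewrite subr_eq0 => /eqP.
by apply/asboolP/eqP.
Qed.

Lemma comb_trans (u e w : I -> V) (a b : I -> I -> D) :
  (forall i, u i = \sum_k a i k *: e k) ->
  (forall k, e k = \sum_j b k j *: w j) ->
  forall i, u i = \sum_j (\sum_k a i k * b k j) *: w j.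
Proof.
move=> ue ew i; rewrite ue.
under eq_bigr do rewrite ew scaler_sumr.
rewrite exchange_big /=; apply: eq_bigr => j _.
by rewrite scaler_suml; apply: eq_bigr => k _; rewrite scalerA.
Qed.

Lemma sum_delta (v : I -> V) i : \sum_j (i == j)%:R *: v j = v i.
Proof.
rewrite (bigD1 i) //= eqxx scale1r big1 ?addr0 // => j.
by rewrite eq_sym => /negPf ->; rewrite scale0r.
Qed.

Lemma fam_matrix_delta :
  fam_matrix (fun i j : I => (i == j)%:R) = 1%:M :> 'M[D]__.
Proof.
by apply/matrixP => i j; rewrite !mxE (inj_eq enum_val_inj).
Qed.

Lemma fam_matrix_inj (a b : I -> I -> D) :
  fam_matrix a = fam_matrix b -> forall i j, a i j = b i j.
Proof.
move=> /matrixP ab i j; have := ab (enum_rank i) (enum_rank j).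
by rewrite !mxE !enum_rankK.
Qed.

Lemma fam_matrix_surj (A : 'M[D]_#|I|) : exists b, fam_matrix b = A.
Proof.
exists (fun i j => A (enum_rank i) (enum_rank j)).
by apply/matrixP => i j; rewrite !mxE !enum_valK.
Qed.

(** If e = B u then u = A B u, and independence of u forces A B = 1; if A is
    invertible then e = A^-1 u lies in the span of u. *)
Lemma basis_det (e u : I -> V) (a : I -> I -> D) :
  spanning e -> lin_indep u -> (forall i, u i = \sum_j a i j *: e j) ->
  is_basis u <-> \det (fam_matrix a) \is a GRing.unit.
Proof.
move=> spe liu ue; split=> [[_ spu]|da].
  have /choice[b eb] k : exists b, e k = \sum_j b j *: u j.
    exact/span_coord/spu.
  suff /mulmx1_unit[] : fam_matrix a *m fam_matrix b = 1%:M by [].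
  rewrite fam_matrix_mul -fam_matrix_delta; apply/matrixP => i j; rewrite !mxE.
  move: (enum_val j); apply: (lin_indep_coord liu).
  by rewrite sum_delta -(comb_trans ue eb).
split=> // x.
have [b bE] := fam_matrix_surj (invmx (fam_matrix a)).
have bu i : e i = \sum_k b i k *: u k.
  rewrite (comb_trans (fun=> erefl) ue) -[LHS]sum_delta.
  have /fam_matrix_inj ba :
      fam_matrix (fun i j => \sum_k b i k * a k j) =
      fam_matrix (fun i j => (i == j)%:R).
    by rewrite -fam_matrix_mul bE mulVmx ?fam_matrix_delta.
  by apply: eq_bigr => j _; rewrite ba.
have [n [f [c ->]]] := spe x; apply: span_bigsum => k _.
by apply: spanZ; rewrite bu; exact: span_sum.
Qed.
End ChangeOfBasis.

Theorem proposition1 (D : idomainType) (M : lmodType D)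
    (tfM : torsion_free M) :
  [/\ (* (a) *)
      forall (I : Type) (u : I -> modfrac M) (m : I -> M) (d : I -> nonzero D),
        is_basis u -> (forall i, u i = mkfrac (m i) (d i)) ->
        is_basis (fun i => tomodfrac (m i)) /\ max_lin_indep m,
      (* (b) *)
      forall (I : Type) (m : I -> M),
        max_lin_indep m <-> is_basis (fun i => tomodfrac (m i)),
      (* (c) *)
      forall (I : Type) (m : I -> M),
        max_lin_indep m ->
        direct_submod_sum (fun i => cyclic_submod (m i)) /\
        essential_submod (submod_sum (fun i => cyclic_submod (m i)))
    & (* (d) *)
      forall (I : finType) (e u : I -> M) (a : I -> I -> D),
        is_basis e -> max_lin_indep u ->
        (forall i, u i = \sum_j a i j *: e j) ->
        (is_basis u <-> \det (fam_matrix a) \is a GRing.unit)].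
Proof.
split.
- move=> I u m d bu um.
  suff bm : is_basis (fun i => tomodfrac (m i)).
    by split=> //; apply/max_lin_indep_tomodfrac.
  have -> : (fun i => tomodfrac (m i)) =
      (fun i => FracField.tofrac (sval (d i)) *: u i).
    apply/funext => i.
    by rewrite um mkfracE scalerA divff ?scale1r ?nonzero_tofrac.
  by apply: is_basis_scale => // i; exact: nonzero_tofrac.
- by move=> I m; exact: max_lin_indep_tomodfrac.
- move=> I m maxm; split; first exact: direct_submod_sum_cyclic (proj1 maxm).
  by rewrite submod_sum_cyclic; exact: essential_span.
- by move=> I e u a [_ spe] [liu _]; exact: basis_det.
Qed.
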